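(* Let $t>0$ be an integer and $0<\delta\le 1$, $c>0$ reals. Then there is a constant $c'>0$ (depending on $t,\delta,c$) such that for every $n$-vertex $K_{2,t}$-minor-free graph $G$ having a vertex $v_0$ of degree at least $c\,n^{\delta}$, every vertex-separating path system $\mathcal{P}$ of $G$ satisfies $|\mathcal{P}| \ge c'\, n^{\epsilon}$, where $\epsilon = \frac{\delta}{t+1}$.
   Context: All graphs are finite, simple, connected with at least 4 vertices. $G$ is $K_{2,t}$-minor-free if the complete bipartite graph $K_{2,t}$ cannot be obtained from $G$ by deleting vertices/edges and contracting edges. A path in $G$ is a sequence of distinct vertices $v_0,\dots,v_r$ ($r\ge0$) with consecutive vertices adjacent. A vertex-separating path system of $G$ is a collection of distinct paths in $G$ such that for every pair of distinct vertices $u,v$ some path in the collection contains exactly one of $u$ and $v$. *)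

(* Defs.v *)
From mathcomp Require Import all_boot.

Set Implicit Arguments.
Unset Strict Implicit.
Unset Printing Implicit Defensive.

Record sgraph := SGraph {
  vertex :> finType;
  adj : rel vertex;
  adj_sym : symmetric adj;
  adj_irrefl : irreflexive adj
}.

Definition connected_graph (G : sgraph) : Prop :=
  forall x y : G, connect (@adj G) x y.

Definition degree (G : sgraph) (v : G) : nat := #|[set u : G | adj v u]|.

Definition graph_iso (G H : sgraph) : Prop :=
  exists2 f : G -> H, bijective f & forall x y : G, adj (f x) (f y) = adj x y.

Section MinorOperations.
Variable G : sgraph.

Section DelVertex.
Variable v : G.
Definition del_vertex_adj : rel {z : G | z != v} :=
  fun a b => adj (val a) (val b).
Lemma del_vertex_sym : symmetric del_vertex_adj.
Proof. by move=> a b; rewrite /del_vertex_adj adj_sym. Qed.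
Lemma del_vertex_irrefl : irreflexive del_vertex_adj.
Proof. by move=> a; rewrite /del_vertex_adj adj_irrefl. Qed.
Definition del_vertex := SGraph del_vertex_sym del_vertex_irrefl.
End DelVertex.

Section Edge.
Variables x y : G.

Definition del_edge_adj : rel G :=
  fun a b => adj a b && ~~ ((a == x) && (b == y) || (a == y) && (b == x)).
Lemma del_edge_sym : symmetric del_edge_adj.
Proof.
by move=> a b; rewrite /del_edge_adj adj_sym orbC [(a == y) && _]andbC
  [(a == x) && _]andbC.
Qed.
Lemma del_edge_irrefl : irreflexive del_edge_adj.
Proof. by move=> a; rewrite /del_edge_adj adj_irrefl. Qed.
Definition del_edge := SGraph del_edge_sym del_edge_irrefl.

(* The vertex obtained by merging x and y is represented by x; loops and
   parallel edges disappear. *)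
Definition contract_adj : rel {z : G | z != y} :=
  fun a b => (a != b) &&
    [|| adj (val a) (val b),
        (val a == x) && adj y (val b)
      | (val b == x) && adj y (val a)].
Lemma contract_sym : symmetric contract_adj.
Proof.
move=> a b; rewrite /contract_adj eq_sym adj_sym.
by congr (_ && (_ || _)); rewrite orbC.
Qed.
Lemma contract_irrefl : irreflexive contract_adj.
Proof. by move=> a; rewrite /contract_adj eqxx. Qed.
Definition contract := SGraph contract_sym contract_irrefl.
End Edge.
End MinorOperations.

(* [minor H G]: a graph isomorphic to H is obtained from G by a finite sequence
   of vertex deletions, edge deletions and edge contractions. *)
Inductive minor (H : sgraph) : sgraph -> Prop :=
| MinorIso (G : sgraph) : graph_iso G H -> minor H G
| MinorDelVertex (G : sgraph) (v : G) : minor H (del_vertex v) -> minor H G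
| MinorDelEdge (G : sgraph) (x y : G) : adj x y -> minor H (del_edge x y) -> minor H G
| MinorContract (G : sgraph) (x y : G) : adj x y -> minor H (contract x y) -> minor H G.

Section CompleteBipartite.
Variables s t : nat.
Definition bip_adj : rel ('I_s + 'I_t)%type :=
  fun a b => match a, b with
             | inl _, inr _ | inr _, inl _ => true
             | _, _ => false
             end.
Lemma bip_sym : symmetric bip_adj.
Proof. by move=> [a|a] [b|b]. Qed.
Lemma bip_irrefl : irreflexive bip_adj.
Proof. by move=> [a|a]. Qed.
Definition complete_bipartite := SGraph bip_sym bip_irrefl.
End CompleteBipartite.

Definition minor_free (H G : sgraph) : Prop := ~ minor H G.

(* The sequence of vertices [:: v_0; ...; v_r]; the case r = 0 is allowed, the
   empty sequence is not. *)
Definition is_path (G : sgraph) (p : seq G) : bool :=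
  [&& p != [::], uniq p & sorted (@adj G) p].

Definition vertex_separating_path_system (G : sgraph) (P : seq (seq G)) : Prop :=
  [/\ uniq P, all (@is_path G) P &
      forall u v : G, u != v -> exists2 p, p \in P & (u \in p) != (v \in p)].

(* Main.v *)
(** Delete [v0] and let [N] be its neighbourhood.  A connected set [B] avoiding [v0], together
    with [t] disjoint connected sets outside [B] that each meet [N] and are adjacent to [B],
    contracts to K_{2,t}.  Applied to the proper ancestors of the lowest vertices of [N] in a
    spanning tree of a component of G - v0, this shows that the vertices of [N] in that
    component lie on at most [t] root paths.  Applied with [B] a segment of a path of the system
    (with [v0] removed), it shows that a root path enters the segment fewer than [t] times, so
    that the segment separates at most [2t] pairs of consecutive vertices of [N].  All
    consecutive pairs must be separated and a segment meets only one component, so the degree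
    of [v0] is O(t^2 k^2) for a system of [k] paths, which suffices because t + 1 >= 2. *)

Require Import Defs.
From mathcomp Require Import all_boot zify.

Set Implicit Arguments.
Unset Strict Implicit.
Unset Printing Implicit Defensive.

(** * Minors from branch-set models *)

(** Edges of [G] sent by [f] to non-edges are deleted one at a time, by induction on the number of
    adjacent pairs; once none is left, [f] is an isomorphism. *)
Lemma minor_spanning (H G : sgraph) (f : G -> H) :
  bijective f -> (forall x y, adj (f x) (f y) -> adj x y) -> minor H G.
Proof.
have [n] := ubnP #|[set p : G * G | adj p.1 p.2]|.
elim: n G f => // n IH G f ltn bijf adjf.
have [/existsP [x /existsP [y /andP [axy naxy]]]|] :=
  boolP [exists x, exists y, adj x y && ~~ adj (f x) (f y)]; last first.
  move=> /existsPn h; apply: MinorIso; exists f => // x y.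
  apply/idP/idP; first exact: adjf.
  by have /existsPn/(_ y) := h x; rewrite negb_and negbK; case: adj.
apply: (MinorDelEdge axy); apply: (IH (del_edge x y) f _ bijf).
  move: ltn; rewrite ltnS; apply: leq_trans; apply/proper_card/properP; split.
    by apply/subsetP => p; rewrite !inE => /andP [].
  by exists (x, y); rewrite !inE //= /del_edge_adj !eqxx /= andbF.
move=> a b fab /=; rewrite /del_edge_adj adjf //=.
apply/negP => /orP [] /andP [/eqP ea /eqP eb]; move: fab naxy; rewrite ea eb.
  by move=> ->.
by rewrite adj_sym => ->.
Qed.

Definition minor_model (H G : sgraph) (phi : G -> option H) : Prop :=
  [/\ forall h, exists x, phi x = Some h,
      forall x y, phi x = phi y -> phi x != None ->
        connect [rel a b | adj a b && (phi a == phi b)] x y &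
      forall h k, adj h k ->
        exists x, exists y, [/\ phi x = Some h, phi y = Some k & adj x y]].

Lemma connect_map (T U : finType) (e : rel T) (e' : rel U) (f : T -> U)
    (P : pred T) :
  (forall x y, P x -> e x y -> P y /\ connect e' (f x) (f y)) ->
  forall x y, P x -> connect e x y -> connect e' (f x) (f y).
Proof.
move=> he x y + /connectP [p]; elim: p x => [|z p IH] x Px /=; first by move=> _ ->.
move=> /andP [exz ep] ey; have [Pz c] := he _ _ Px exz.
exact: connect_trans c (IH _ Pz ep ey).
Qed.

(** Induction on [#|G|]: a vertex sent to [None] is deleted, an edge inside a fibre is contracted.
    If neither exists, [phi] is injective, so [G] has the vertex set of [H] and at least its
    edges. *)
Lemma minor_of_model (H G : sgraph) (phi : G -> option H) :
  minor_model phi -> minor H G.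
Proof.
have [n] := ubnP #|G|; elim: n G phi => // n IH G phi ltn [surj conn edge].
have card_del (v : G) : #|{: {z : G | z != v}}| < n.
  by rewrite card_sig cardC1; move: ltn; have := max_card (pred1 v); rewrite card1; case: #|_|.
have [/existsP [v /eqP phiv]|] := boolP [exists v, phi v == None].
  apply: (@MinorDelVertex _ _ v).
  apply: (IH (del_vertex v) (fun z => phi (val z)) (card_del v)).
  have ne z h : phi z = Some h -> z != v by apply: contra_eqN => /eqP ->; rewrite phiv.
  split=> [h|x y exy nx|h k /edge [x [y [hx hy a]]]].
  - by have [x hx] := surj h; exists (exist _ x (ne _ _ hx)).
  - pose f z : del_vertex v := insubd x z.
    pose e' := [rel a b : del_vertex v | adj a b && (phi (val a) == phi (val b))].
    have := connect_map (e' := e') (f := f) (P := fun z => phi z != None) _ nx (conn _ _ exy nx).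
    rewrite /f !valKd; apply => a b na /andP [aab /eqP eab]; split; first by rewrite -eab.
    have nv z : phi z != None -> z != v by apply: contra => /eqP ->; rewrite phiv.
    have nva : a != v := nv _ na; have nvb : b != v by apply: nv; rewrite -eab.
    by apply: connect1; rewrite /= /del_vertex_adj !insubdK // aab eab eqxx.
  - by exists (exist _ x (ne _ _ hx)), (exist _ y (ne _ _ hy)).
move=> /existsPn nN.
have [/existsP [x /existsP [y /andP [axy /eqP exy]]]|] :=
  boolP [exists x, exists y, adj x y && (phi x == phi y)].
  apply: (MinorContract axy).
  apply: (IH (contract x y) (fun z => phi (val z)) (card_del y)).
  have nxy : x != y by apply: contraTneq axy => ->; rewrite adj_irrefl.
  pose x' : contract x y := exist _ x nxy.
  (* The default value does the merging: [y] alone lies outside the subtype, so [insubd] sends it to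
     [x']. *)
  pose f z : contract x y := insubd x' z.
  have phif z : phi (val (f z)) = phi z.
    by rewrite val_insubd; case: eqP => // ->.
  have adjf a b : adj a b -> (f a == f b) || adj (f a) (f b).
    move=> aab; rewrite /= /contract_adj; case: eqP => //= _.
    rewrite !val_insubd; case: (eqVneq a y) => [ea|na]; case: (eqVneq b y) => [eb|nb] /=.
    - by move: aab; rewrite ea eb adj_irrefl.
    - by rewrite eqxx -ea aab !orbT.
    - by rewrite eqxx -eb (adj_sym b a) aab !orbT.
    - by rewrite aab.
  split=> [h|a b eab na|h k ahk].
  - by have [z hz] := surj h; exists (f z); rewrite phif.
  - pose e' := [rel a b : contract x y | adj a b && (phi (val a) == phi (val b))].
    have := connect_map (e' := e') (f := f) (P := predT) _ isT (conn _ _ eab na).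
    have fK z : f (val z) = z by rewrite /f valKd.
    rewrite !fK; apply => c d _ /andP [acd ecd]; split => //.
    have /orP [/eqP ->//|a'] := adjf _ _ acd.
    by apply/connect1/andP; split; [exact: a' | rewrite !phif].
  - have [a [b [ha hb aab]]] := edge _ _ ahk; exists (f a), (f b); rewrite !phif; split=> //.
    have /orP [/eqP e|//] := adjf _ _ aab.
    move: ahk; suff -> : h = k by rewrite adj_irrefl.
    by apply: Some_inj; rewrite -ha -hb -(phif a) e phif.
move=> /existsPn nE.
(* A nontrivial walk inside a fibre would begin with an edge inside that fibre. *)
have inj : injective phi.
  move=> x y exy; have /connectP [[|z p] /=] := conn _ _ exy (nN x); first by move=> _ ->.
  by move=> /andP [/andP[a e] _]; have /existsPn/(_ z) := nE x; rewrite a e.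
have phiS x : {h | phi x = Some h} by have := nN x; case: (phi x) => // h; exists h.
pose f x := sval (phiS x).
have phif x : phi x = Some (f x) := svalP (phiS x).
have injf : injective f by move=> x y exy; apply: inj; rewrite !phif exy.
apply: (@minor_spanning _ _ f).
  apply: inj_card_bij => //; rewrite -(card_image injf); apply/subset_leq_card/subsetP => h _.
  by have [x hx] := surj h; apply/imageP; exists x => //; move: hx; rewrite phif => -[].
move=> x y /edge [a [b [ha hb aab]]].
have -> : x = a by apply: inj; rewrite phif ha.
by have -> : y = b by apply: inj; rewrite phif hb.
Qed.

(** * Connected sets and rooted [K_{2,t}] minors *)

Definition conn_set (G : sgraph) (A : {set G}) : Prop :=
  {in A &, forall x y, connect [rel a b | [&& adj a b, a \in A & b \in A]] x y}.

Lemma conn_set_sym (G : sgraph) (A : {set G}) :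
  connect_sym [rel a b : G | [&& adj a b, a \in A & b \in A]].
Proof. by apply: sym_connect_sym => a b /=; rewrite adj_sym (andbC (a \in A)). Qed.

Lemma conn_set_path (G : sgraph) (s : seq G) :
  sorted (@adj G) s -> conn_set [set z in s].
Proof.
case: s => [|h s] srt x y; first by rewrite inE.
rewrite !inE => xs ys.
set e := (X in connect X).
have ep : path e h s.
  apply: (@sub_in_path _ (mem (h :: s)) (@adj G)) srt; last exact/allP.
  by move=> a b ha hb ab; apply/and3P; split; rewrite ?in_set.
apply: (@connect_trans _ _ h); last exact: (path_connect ep).
by rewrite conn_set_sym; apply: (path_connect ep).
Qed.

Lemma find_flatten (T : eqType) (As : seq (seq T)) i z :
  uniq (flatten As) -> z \in nth [::] As i -> find (fun A => z \in A) As = i.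
Proof.
elim: As i => [|A As IH] [|i] //=; first by move=> _ ->.
rewrite cat_uniq => /and3P [_ /hasPn nA uAs] zi; rewrite (IH i) //.
rewrite (negbTE (nA z _)) //; apply/flattenP; exists (nth [::] As i) => //.
by apply: mem_nth; case: ltnP zi => // le; rewrite nth_default.
Qed.

(** The branch sets are [v0] alone and [B] on the side of size two, and the first [t] members of
    [As], connected because they are walks, on the other. *)
Lemma rooted_minor (G : sgraph) (t : nat) (v0 : G) (B : {set G}) (As : seq (seq G)) :
  0 < t -> v0 \notin B -> conn_set B -> uniq (flatten As) ->
  (forall A, A \in As ->
    [/\ sorted (@adj G) A, v0 \notin A, {in A, forall z, z \notin B},
        exists2 u, u \in A & adj v0 u &
        exists2 a, a \in A & exists2 b, b \in B & adj a b]) ->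
  t <= size As -> minor (complete_bipartite 2 t) G.
Proof.
move=> t0 v0B cB uAs hAs ts.
(* A vertex in no block gets index [size As], which is at least [t]; so [insub] discards it together
   with all surplus blocks. *)
pose idx z : option 'I_t := insub (find (fun A => z \in A) As).
pose phi z : option (complete_bipartite 2 t) :=
  if z == v0 then Some (inl ord0) else if z \in B then Some (inl ord_max)
  else omap inr (idx z).
have inAs (i : 'I_t) : nth [::] As i \in As by apply: mem_nth; apply: leq_trans ts.
have phiv : phi v0 = Some (inl ord0) by rewrite /phi eqxx.
have phiB z : z \in B -> phi z = Some (inl ord_max).
  by move=> zB; rewrite /phi zB; case: eqP => // e; rewrite e (negbTE v0B) in zB.
have phiA z (i : 'I_t) : z \in nth [::] As i -> phi z = Some (inr i).
  move=> zi; have [_ v0A AB _ _] := hAs _ (inAs i).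
  rewrite /phi (negbTE (AB _ zi)); case: eqP => [e|_]; first by rewrite -e zi in v0A.
  by rewrite /idx (find_flatten uAs zi) valK.
have phiBK z : phi z = Some (inl ord_max) -> z \in B.
  by rewrite /phi; case: ifP => // _; case: ifP => // _; case: (idx z).
have phivK z : phi z = Some (inl ord0) -> z = v0.
  rewrite /phi; case: eqP => // _; case: ifP => // _; by case: (idx z).
have phiAK z i : phi z = Some (inr i) -> z \in nth [::] As i.
  rewrite /phi; case: ifP => // _; case: ifP => // _; rewrite /idx.
  case: insubP => //= j _ ej [<-]; rewrite ej.
  by apply: (@nth_find _ [::] (fun A => z \in A)); rewrite has_find -ej; apply: leq_trans ts.
have nbr (i : 'I_t) : exists2 a, phi a = Some (inr i) & adj v0 a.
  by have [_ _ _ [a /phiA ea aa] _] := hAs _ (inAs i); exists a.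
have nbrB (i : 'I_t) : exists2 a, phi a = Some (inr i) &
    exists2 b, phi b = Some (inl ord_max) & adj b a.
  have [_ _ _ _ [a /phiA ea [b /phiB eb ab]]] := hAs _ (inAs i).
  by exists a => //; exists b => //; rewrite adj_sym.
have ord2 (i : 'I_2) : i = ord0 \/ i = ord_max.
  by case: i => [[|[|//]] p]; [left|right]; apply: val_inj.
apply: (@minor_of_model _ _ phi); split.
- case=> [i|i]; last by have [a] := nbr i; exists a.
  have [->|->] := ord2 i; first by exists v0.
  by have [a _ [b eb _]] := nbrB (Ordinal t0); exists b.
- move=> x y exy nx.
  have sub (A : {set G}) h : (forall z, z \in A -> phi z = Some h) -> conn_set A ->
      x \in A -> y \in A -> connect [rel a b | adj a b && (phi a == phi b)] x y.
    move=> hA cA xA yA; move: (cA _ _ xA yA); apply: connect_sub => a b /= /and3P [ab aA bA].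
    by apply: connect1; rewrite /= ab (hA a) // (hA b) //=.
  case ex : (phi x) nx => [[i|i]|] // _; rewrite ex in exy; last first.
    have [sA _ _ _ _] := hAs _ (inAs i).
    apply: (sub [set z in nth [::] As i] (inr i)); rewrite ?inE; try exact: phiAK.
      by move=> z; rewrite inE; apply: phiA.
    exact: conn_set_path.
  have [ei|ei] := ord2 i; rewrite ei in ex exy.
    by rewrite (phivK _ ex) (phivK y).
  by apply: (sub B (inl ord_max)); rewrite // phiBK.
- have main i j : exists x, exists y, [/\ phi x = Some (inl i), phi y = Some (inr j) & adj x y].
    have [->|->] := ord2 i; first by have [a] := nbr j; exists v0, a.
    by have [a ea [b eb ab]] := nbrB j; exists b, a.
  case=> [i|i] [j|j] h; [by [] | exact: main | | by []].
  by have [x [y [? ? ?]]] := main j i; exists y, x; rewrite adj_sym.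
Qed.

(** * Entries and crossings along a sequence *)

Definition consec (T : Type) (s : seq T) : seq (T * T) := zip s (behead s).

Definition entries (T : Type) (a : pred T) (s : seq T) : nat :=
  count (fun p => ~~ a p.1 && a p.2) (consec s).

Definition crossings (T : Type) (a : pred T) (s : seq T) : nat :=
  count (fun p => a p.1 != a p.2) (consec s).

Lemma consec_cons (T : Type) (x y : T) s :
  consec (x :: y :: s) = (x, y) :: consec (y :: s).
Proof. by []. Qed.

Lemma size_consec (T : Type) (s : seq T) : size (consec s) = (size s).-1.
Proof. by rewrite size_zip size_behead; lia. Qed.

Lemma consecP (T : eqType) (s : seq T) p : uniq s -> p \in consec s ->
  [/\ p.1 \in s, p.2 \in s & p.1 != p.2].
Proof.
elim: s => // x [|y s] // IH /andP [xs us].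
rewrite consec_cons inE => /orP [/eqP ->|/(IH us) [p1 p2 ne]] /=.
  by rewrite !inE !eqxx orbT; split=> //; apply: contraNneq xs => ->; rewrite inE eqxx.
by rewrite !(in_cons x) p1 p2 !orbT.
Qed.

(** Entries and exits alternate, so exits outnumber entries by at most one. *)
Lemma crossings_entries (T : Type) (a : pred T) (s : seq T) :
  crossings a s <= (entries a s).*2.+1.
Proof.
(* The induction needs the sharper form: the extra exit occurs only if the sequence starts inside
   [a]. *)
case: s => // x s; suff : crossings a (x :: s) <= (entries a (x :: s)).*2 + a x.
  by case: (a x); lia.
elim: s x => // y s IH x; have := IH y.
rewrite /crossings /entries consec_cons /=.
by case: (a x); case: (a y) => /=; lia.
Qed.

Lemma entries_cat (T : Type) (a : pred T) (s1 s2 : seq T) :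
  all (predC a) s1 -> entries a (s1 ++ s2) <= (entries a s2).+1.
Proof.
elim: s1 => [|x [|y s1] IH] //= /andP [nx al].
  by case: s2 {IH} => //= y s2; rewrite {1}/entries consec_cons /= nx; case: (a y).
by apply: leq_trans (IH al); rewrite {1}/entries consec_cons /= (negbTE (proj1 (andP al))) andbF.
Qed.

Lemma entries0 (T : Type) (a : pred T) (s : seq T) :
  all (predC a) s -> entries a s = 0.
Proof.
elim: s => // x [|y s] IH // /andP [nx al].
by move: (IH al); rewrite /entries consec_cons /= (negbTE (proj1 (andP al))) andbF.
Qed.

Lemma entries_cons (T : Type) (a : pred T) x (s : seq T) :
  a x -> entries a (x :: s) = entries a s.
Proof. by case: s => // y s ax; rewrite /entries consec_cons /= ax. Qed.

(* Each entry into [a] ends a maximal [a]-free stretch of the path; these are the blocks. *)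
Lemma entry_blocks (T : eqType) (e : rel T) (N a : pred T) (R : seq T) :
  sorted e R -> exists As : seq (seq T),
    [/\ subseq (flatten As) R, entries a (filter N R) <= size As &
      forall A, A \in As ->
        [/\ sorted e A, {in A, forall z, ~~ a z}, has N A &
            exists2 x, x \in A & exists2 y, a y & e x y]].
Proof.
have [n] := ubnP (size R); elim: n R => // n IH [|z R] ltn srt; first by exists [::].
have srtR := path_sorted srt.
have [As [sub le hAs]] := IH R ltn srtR.
case Nz : (N z); last first.
  by exists As; rewrite /= Nz; split=> //; apply: subseq_trans (subseq_cons _ _).
case az : (a z).
  by exists As; rewrite /= Nz entries_cons //; split=> //; apply: subseq_trans (subseq_cons _ _).
have [/hasP|/hasPn nR] := boolP (has a R); last first.
  exists [::]; rewrite sub0seq /= Nz entries0; first by split.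
  rewrite /= az /=; apply/allP => x; rewrite mem_filter => /andP [_]; exact: nR.
(* With [y] the first vertex of [a] after [z], the block is [z :: R1]: it contains the [N]-vertex
   [z], avoids [a], and ends next to [y]. It accounts for at most one entry, and the recursion
   resumes at [y]. *)
move=> /hasP hR; case: (split_find hR) ltn srt => y R1 R2 ay nR1.
rewrite cat_rcons => ltn srt {As sub le hAs srtR hR}.
have ltn2 : size (y :: R2) < n by move: ltn; rewrite /= size_cat /=; lia.
move: srt; rewrite /= cat_path => /andP [p1 /= /andP [ey p2]].
have [As [sub le hAs]] := IH (y :: R2) ltn2 p2.
exists ((z :: R1) :: As); split.
- by rewrite /= eqxx; apply: cat_subseq.
- rewrite -[X in entries a X]/(filter N ((z :: R1) ++ y :: R2)) filter_cat.
  apply: leq_trans (entries_cat _ _) _; last by [].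
  apply/allP => x; rewrite mem_filter inE => /andP [_ /orP [/eqP ->|]]; rewrite /= ?az //.
  by move=> xR; apply: contra nR1 => ax; apply/hasP; exists x.
- move=> A; rewrite inE => /orP [/eqP ->|]; last exact: hAs.
  split=> //=; last by exists (last z R1); [exact: mem_last | exists y].
    move=> x; rewrite inE => /orP [/eqP ->|]; rewrite ?az //.
    by move=> xR; apply: contra nR1 => ax; apply/hasP; exists x.
  by rewrite Nz.
Qed.

(** * Spanning forests and root paths *)

(** A breadth-first forest: [rk] is the distance to the root of the component, and [par] takes the
    first step of a shortest walk there. *)
Lemma spanning_forest (T : finType) (e : rel T) :
  connect_sym e -> exists (par : T -> T) (rk : T -> nat), forall x,
    (par x = x /\ x = root e x) \/ (e x (par x) /\ rk (par x) < rk x).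
Proof.
move=> symE.
pose P x n := [exists p : n.-tuple T, path e x p && (last x p == root e x)].
have exP x : exists n, P x n.
  have /connectP [p ep lp] := connect_root e x.
  by exists (size p); apply/existsP; exists (in_tuple p); rewrite ep lp eqxx.
pose rk x := ex_minn (exP x).
have step x : exists y, (y = x /\ x = root e x) \/ (e x y /\ rk y < rk x).
  rewrite {2}/rk; case: ex_minnP => n /existsP [p /andP [ep /eqP lp]] _.
  case: p ep lp => [[|y p] /= /eqP sp]; first by move=> _ e0; exists x; left.
  move=> /andP [exy ep] lp; exists y; right; split=> //.
  rewrite /rk; case: ex_minnP => m _ minm; rewrite -sp ltnS; apply: minm.
  apply/existsP; exists (in_tuple p); rewrite ep lp; apply/eqP/(rootP symE).
  exact: connect1.
have [par hpar] : exists par : T -> T, forall x,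
    (par x == x) && (x == root e x) || (e x (par x) && (rk (par x) < rk x)).
  have h x : exists y, (y == x) && (x == root e x) || (e x y && (rk y < rk x)).
    have [y [[_ e0]|[exy lt]]] := step x; first by exists x; rewrite -e0 !eqxx.
    by exists y; rewrite exy lt orbT.
  by exists (fun x => xchoose (h x)) => x; apply: (xchooseP (h x)).
exists par, rk => x; have /orP [/andP [/eqP e1 /eqP e2]|/andP [? ?]] := hpar x; by [left|right].
Qed.

(** An orbit list has no repetition, so none of its steps starts at a fixed point of [f]. For a
    parent map the orbit is the root path. *)
Lemma path_orbit (T : finType) (e : rel T) (f : T -> T) x :
  (forall z, f z != z -> e z (f z)) -> sorted e (orbit f x).
Proof.
move=> fe; have := orbit_uniq f x.
rewrite /orbit; case: (order f x) => //= n; have := fpath_traject f x n.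
move: (traject f (f x) n) => p; elim: p x => //= y s IH x /andP [/eqP exy fp] /andP [xs us].
rewrite (IH y) // andbT -exy fe // exy; apply: contraNneq xs => ->.
exact: mem_head.
Qed.

(** * Bounding the degree of [v0] by separating segments *)

Section Bound.
Variables (G : sgraph) (t : nat) (v0 : G).
Hypothesis t_gt0 : 0 < t.
Hypothesis freeG : ~ minor (complete_bipartite 2 t) G.
Variable S : seq (seq G).
Hypothesis pathS : forall s, s \in S -> sorted (@adj G) s /\ v0 \notin s.
Let N := [set u : G | adj v0 u].
Hypothesis sepS : {in N &, forall x y, x != y ->
  exists2 s, s \in S & (x \in s) != (y \in s)}.

(** The graph [G - v0], kept on the vertex type of [G] with [v0] isolated. *)
Let e := [rel a b : G | [&& adj a b, a != v0 & b != v0]].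

(** Double counting: a consecutive pair is two distinct vertices of [N], so some [s] separates it
    and has a crossing there. *)
Lemma size_consec_crossings ws : uniq ws -> {subset ws <= N} ->
  size (consec ws) <= \sum_(s <- S) crossings (mem s) ws.
Proof.
move=> uws wsN; rewrite /crossings.
under eq_bigr => s _ do rewrite -sum1_count big_mkcond /=.
rewrite exchange_big /= -sum1_size big_seq [X in _ <= X]big_seq.
apply: leq_sum => p pc; have [p1 p2 ne] := consecP uws pc.
have [s sS sp] := sepS (wsN _ p1) (wsN _ p2) ne.
by rewrite (big_rem s) //= sp.
Qed.

(** With [s] as the connected set, [t] entry blocks of [R] would form a rooted minor. So there are
    at most [t - 1] entries, hence at most [2(t - 1) + 1] crossings. *)
Lemma segment_crossings R s : s \in S -> sorted (@adj G) R -> uniq R -> v0 \notin R ->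
  crossings (mem s) (filter (mem N) R) <= t.*2.
Proof.
move=> sS srt uR vR; have [srts v0s] := pathS sS.
have [As [sub le hAs]] := entry_blocks (mem N) (mem s) srt.
apply: leq_trans (crossings_entries _ _) _.
have /leq_trans -> // : (entries (mem s) (filter (mem N) R)).*2.+1 <= (size As).*2.+1.
  by rewrite ltnS leq_double.
rewrite ltn_double.
rewrite ltnNge; apply/negP => ts; apply: freeG.
apply: (@rooted_minor _ _ v0 [set z in s] As) => //.
- by rewrite inE.
- exact: conn_set_path.
- exact: subseq_uniq uR.
move=> A AAs; have [sA nA /hasP [u uA uN] [x xA [y ys exy]]] := hAs _ AAs.
split=> //.
- apply: contra vR => vA; apply: (mem_subseq sub); apply/flattenP; by exists A.
- by move=> z zA; rewrite inE; apply: nA.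
- by exists u => //; move: uN; rewrite /= inE.
- by exists x => //; exists y; rewrite ?inE.
Qed.

Lemma rooted_path_bound R : sorted (@adj G) R -> uniq R -> v0 \notin R ->
  size (filter (mem N) R) <= (size S * t.*2).+1.
Proof.
move=> srt uR vR; set ws := filter _ R.
have : (size ws).-1 <= size S * t.*2; last by case: size.
rewrite -size_consec; apply: (leq_trans (size_consec_crossings _ _)).
- exact: filter_uniq.
- by move=> z; rewrite mem_filter => /andP [].
rewrite -sum1_size big_distrl /= big_seq [X in _ <= X]big_seq.
by apply: leq_sum => s sS; rewrite mul1n; apply: segment_crossings.
Qed.

Lemma away_connect_sym : connect_sym e.
Proof. by apply: sym_connect_sym => a b /=; rewrite adj_sym (andbC (a != v0)). Qed.

Lemma nbr_neq w : w \in N -> w != v0.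
Proof. by rewrite inE; apply: contraTneq => ->; rewrite adj_irrefl. Qed.

(** A segment stays in one component of [G - v0]. Neighbours of [v0] in components met by no segment
    cannot be separated from each other, so at most one such component contains a neighbour. *)
Lemma card_nbr_components : #|[set root e w | w in N]| <= (size S).+1.
Proof.
set Rts := [set _ | _ in _].
(* For an empty segment the default [v0] adds a spurious root, which only enlarges [hit]. *)
pose hit := [set z in [seq root e (head v0 s) | s <- S]].
have nohit s w : s \in S -> w \in s -> root e w \in hit.
  move=> sS ws; rewrite inE; apply/mapP; exists s => //.
  apply/(rootP away_connect_sym); rewrite away_connect_sym.
  have [srt v0s] := pathS sS; case: s {sS} srt v0s ws => //= a s srt v0s ws.
  apply: (@path_connect _ e a s) => //.
  apply: (@sub_in_path _ [pred z | z != v0] (@adj G)) srt => [x y xv yv xy|].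
    by apply/and3P.
  by apply/allP => z zs /=; apply: contraNneq v0s => <-.
rewrite -(cardsID hit) -addn1; apply: leq_add.
  apply: leq_trans (subset_leq_card (subsetIr _ _)) _.
  by rewrite cardsE; apply: leq_trans (card_size _) _; rewrite size_map.
apply/card_le1_eqP => _ _ /setDP [/imsetP [w1 w1N ->] n1] /setDP [/imsetP [w2 w2N ->] n2].
have [->//|ne] := eqVneq w1 w2.
have [s sS] := sepS w1N w2N ne.
case h1 : (w1 \in s); first by rewrite (nohit _ _ sS h1) in n1.
case h2 : (w2 \in s) => //; by rewrite (nohit _ _ sS h2) in n2.
Qed.

(** The factors bound, in order, the components containing neighbours, the lowest neighbours in one
    component, and the neighbours on one root path. *)
Lemma degree_bound : degree v0 <= (size S).+1 * t * (size S * t.*2).+1.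
Proof.
have [par [rk hpar]] := spanning_forest away_connect_sym.
have par_root z : par z = z -> z = root e z.
  by case: (hpar z) => [[]//|[/and3P [a _ _] _]] e0; rewrite e0 adj_irrefl in a.
have par_e z : par z != z -> e z (par z) /\ rk (par z) < rk z.
  by case: (hpar z) => [[-> _]|//]; rewrite eqxx.
have par_adj z : par z != z -> adj z (par z) by case/par_e => /and3P [].
have rk_anc w a : fconnect par w a -> a != w -> rk a < rk w.
  move=> /iter_findex <-; elim: (findex par w a) => [|n IH] /=; first by rewrite eqxx.
  set z := iter n par w in IH *.
  have [->//|/par_e [_ lt]] := eqVneq (par z) z => _.
  have [<-//|/IH] := eqVneq z w; exact: ltn_trans.
have root_anc w a : fconnect par w a -> root e a = root e w.
  move=> /iter_findex <-; elim: (findex par w a) => [//|n IH] /=; rewrite -IH.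
  set z := iter n par w; have [->//|/par_e [ez _]] := eqVneq (par z) z.
  by apply/esym/(rootP away_connect_sym)/connect1.
have ne_anc w a : w != v0 -> fconnect par w a -> a != v0.
  move=> wv /iter_findex <-; elim: (findex par w a) => [//|n IH] /=.
  set z := iter n par w in IH *.
  by have [->//|/par_e [/and3P []]] := eqVneq (par z) z.
have anc_root w : fconnect par w (root e w).
  have [n] := ubnP (rk w); elim: n w => // n IH w ltn.
  case: (hpar w) => [[_ <-]|[ew lt]]; first exact: connect0.
  have /(rootP away_connect_sym) -> := connect1 ew.
  by apply: connect_trans (fconnect1 _ _) (IH _ _); apply: leq_trans lt _.
(* The lowest neighbours: those that are an ancestor of no other neighbour. *)
pose L := [set w in N | [forall w' in N, fconnect par w' w ==> (w' == w)]].
have leafP w w' : w \in L -> w' \in N -> fconnect par w' w -> w' = w.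
  by rewrite inE => /andP [_ /forall_inP h] /h /implyP h' /h' /eqP.
have LN w : w \in L -> w \in N by rewrite inE => /andP [].
have cover u : u \in N -> exists2 w, w \in L & fconnect par w u.
  move=> uN; have Pu : (u \in N) && fconnect par u u by rewrite uN connect0.
  case: (@arg_maxnP _ u (fun w => (w \in N) && fconnect par w u) rk Pu).
  move=> w /andP [wN wu] maxw; exists w => //.
  (* [w] has maximal rank among the neighbours below [u]; a further neighbour below [w] would have
     larger rank. *)
  rewrite inE wN; apply/forall_inP => w' w'N; apply/implyP => w'w.
  apply: contraT; rewrite eq_sym => ne; have lt := rk_anc _ _ w'w ne.
  suff : rk w' <= rk w by rewrite leqNgt lt.
  by apply: maxw; rewrite w'N /=; apply: connect_trans w'w wu.
have cardL r : #|[set w in L | root e w == r]| <= t.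
  set Lr := [set _ in _ | _]; rewrite leqNgt; apply/negP => ltL; apply: freeG.
  have LrP w : w \in Lr -> w \in L /\ root e w = r by rewrite inE => /andP [? /eqP].
  (* Proper ancestors of the vertices of [Lr]. They are closed under [par], hence joined through
     [r], and contain no vertex of [Lr] by [leafP]; the other branch sets are the singletons of
     [Lr]. *)
  pose B := [set a | [exists w in Lr, (a != w) && fconnect par w a]].
  have BP a : reflect (exists w, [/\ w \in Lr, a != w & fconnect par w a]) (a \in B).
    rewrite inE; apply: (iffP exists_inP) => [[w wL /andP [? ?]]|[w [wL ? ?]]]; exists w => //.
    exact/andP.
  have Br a : a \in B -> root e a = r.
    by move=> /BP [w [/LrP [_ <-] _ /root_anc]].
  have connB a : a \in B -> connect [rel a b : G | [&& adj a b, a \in B & b \in B]] a r.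
    have [n] := ubnP (rk a); elim: n a => // n IH a ltn aB.
    have [ea|pa] := eqVneq (par a) a; first by rewrite -(Br _ aB) -(par_root _ ea) connect0.
    have [/and3P [aa _ _] lt] := par_e _ pa.
    have pB : par a \in B.
      have /BP [w [wL ne wa]] := aB; apply/BP; exists w; split=> //.
        by apply: contraTneq lt => ->; rewrite -leqNgt ltnW // rk_anc.
      exact: connect_trans wa (fconnect1 _ _).
    apply: connect_trans (IH _ _ pB); last exact: leq_trans lt _.
    by apply: connect1; rewrite /= aa aB.
  apply: (@rooted_minor _ _ v0 B [seq [:: w] | w <- enum Lr]) => //.
  - apply/negP => /BP [w [/LrP [/LN/nbr_neq wv _] _ /(ne_anc _ _ wv)]].
    by rewrite eqxx.
  - move=> a b aB bB; apply: connect_trans (connB _ aB) _.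
    by rewrite conn_set_sym connB.
  - have -> : flatten [seq [:: w] | w <- enum Lr] = enum Lr by elim: (enum Lr) => //= ? ? ->.
    exact: enum_uniq.
  - move=> A /mapP [w wLr ->] {A}; rewrite mem_enum in wLr; have [wL rw] := LrP _ wLr.
    have wN := LN _ wL; split=> //.
    + by rewrite inE eq_sym nbr_neq.
    + move=> z; rewrite inE => /eqP ->; apply/negP => /BP.
      move=> [w' [/LrP [/LN w'N _] ne /(leafP _ _ wL w'N) ew]].
      by rewrite ew eqxx in ne.
    + by exists w; rewrite ?inE //; move: wN; rewrite inE.
    (* If [w] were the root, it would be an ancestor of a second vertex of [Lr], which exists
       because [#|Lr| > t > 0]; this contradicts [leafP]. *)
    + have pw : par w != w.
        apply/eqP => pw; have rr : w = r by rewrite -rw -par_root.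
        have [w2 w2L ne] : exists2 w2, w2 \in Lr & w2 != w.
          have /card_gt1P [x [y [xL yL xy]]] : 1 < #|Lr| by lia.
          have [ex|] := eqVneq x w; last by exists x.
          by exists y => //; rewrite -ex eq_sym.
        have [w2L' r2] := LrP _ w2L.
        have := anc_root w2; rewrite r2 -rr => /(leafP _ _ wL (LN _ w2L')) ew.
        by rewrite ew eqxx in ne.
      exists w; first by rewrite inE.
      exists (par w); last exact: par_adj.
      by apply/BP; exists w; rewrite pw wLr fconnect1.
  - by rewrite size_map -cardE ltnW.
have cardL' : #|L| <= (size S).+1 * t.
  apply: leq_trans (leq_mul card_nbr_components (leqnn t)).
  rewrite -sum1_card (partition_big (root e) (mem [set root e w | w in N])) /=; last first.
    by move=> w wL; apply: imset_f; apply: LN.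
  rewrite -sum1_card big_distrl /=; apply: leq_sum => r _; rewrite mul1n.
  by rewrite sum1_card -(cardsE (fun w => (w \in L) && (root e w == r))); apply: cardL.
have cardO w : w \in L -> #|[set u in N | fconnect par w u]| <= (size S * t.*2).+1.
  move=> wL; have wv := nbr_neq (LN _ wL).
  have := @rooted_path_bound (orbit par w) (path_orbit _ par_adj) (orbit_uniq _ _).
  rewrite -fconnect_orbit; have nv : ~~ fconnect par w v0.
    by apply/negP => /(ne_anc _ _ wv); rewrite eqxx.
  move=> /(_ nv); apply: leq_trans.
  rewrite cardE; apply: uniq_leq_size; first exact: enum_uniq.
  by move=> z; rewrite mem_enum inE mem_filter fconnect_orbit.
apply: leq_trans (leq_mul cardL' (leqnn _)).
rewrite /degree -/N -sum1_card -[in X in _ <= X]sum1_card big_distrl /=.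
(* By [cover], each neighbour is counted on the root path of at least one [w] in [L]. *)
apply: (@leq_trans (\sum_(w in L) \sum_(u in N | fconnect par w u) 1)); last first.
  by apply: leq_sum => w wL; rewrite mul1n sum1_card -(cardsE (fun u => (u \in N) && _)); apply: cardO.
rewrite (exchange_big_dep (mem N)) /=; last by move=> w u _ /andP [].
apply: leq_sum => u uN; have [w wL wu] := cover u uN.
by rewrite (bigD1 w) //= wL uN.
Qed.
End Bound.

(** * From path systems to segments avoiding [v0] *)

(** If [v] is absent, [index] returns [size p], so the first piece is all of [p] and the second is
    empty. *)
Lemma split_around (T : eqType) (v : T) (p : seq T) : uniq p ->
  [/\ v \notin take (index v p) p, v \notin drop (index v p).+1 p &
    forall x, x != v ->
      (x \in p) = (x \in take (index v p) p) || (x \in drop (index v p).+1 p)].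
Proof.
have [vp|vp] := boolP (v \in p); last first.
  rewrite (memNindex vp) take_size drop_oversize // => _; split=> // x _.
  by rewrite orbF.
case/path.splitP: vp => p1 p2; rewrite cat_rcons cat_uniq /= negb_or.
move=> /and4P [_ /andP [v1 _] v2 _]; split=> // x xv.
by rewrite mem_cat inE (negbTE xv).
Qed.

(** Cutting every path at [v0] gives two segments per path, and a path separating two vertices other
    than [v0] has a segment separating them. *)
Lemma degree_path_system (G : sgraph) (t : nat) (v0 : G) (P : seq (seq G)) :
  0 < t -> 1 < #|G| -> minor_free (complete_bipartite 2 t) G ->
  vertex_separating_path_system P -> degree v0 <= 15 * (t * size P) ^ 2.
Proof.
move=> t0 /card_gt1P [x [y [_ _ ne]]] freeG [_ /allP pathP sepP].
have k0 : 0 < size P by have [p pP _] := sepP _ _ ne; case: P pP {pathP sepP}.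
pose before p := take (index v0 p) p; pose after p := drop (index v0 p).+1 p.
pose S := map before P ++ map after P.
have pathS s : s \in S -> sorted (@adj G) s /\ v0 \notin s.
  rewrite mem_cat => /orP [] /mapP [p /pathP /and3P [_ up srt] ->];
    have [vb va _] := split_around v0 up; split=> //.
    exact: take_sorted.
  exact: drop_sorted.
have sepS : {in [set u | adj v0 u] &, forall a b, a != b ->
    exists2 s, s \in S & (a \in s) != (b \in s)}.
  move=> a b /nbr_neq av /nbr_neq bv /sepP [p pP].
  have /and3P [_ up _] := pathP _ pP; have [_ _ memp] := split_around v0 up.
  rewrite !memp // -/(before p) -/(after p).
  case: (eqVneq (a \in before p) (b \in before p)) => [->|sb _].
    case: (eqVneq (a \in after p) (b \in after p)) => [->|sa _]; first by rewrite eqxx.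
    by exists (after p); rewrite // mem_cat map_f ?orbT.
  by exists (before p); rewrite // mem_cat map_f.
apply: leq_trans (degree_bound t0 freeG pathS sepS) _.
have -> : size S = (size P).*2 by rewrite size_cat !size_map addnn.
(* For [k, t >= 1]: [2k + 1 <= 3k] and [4kt + 1 <= 5kt], whence the constant [15]. *)
by move: k0 t0; move: (size P) => k; nia.
Qed.

(* Passage to real exponents *)
From mathcomp Require Import all_order all_algebra.
From mathcomp Require Import all_classical all_reals all_analysis.
Import Order.TTheory GRing.Theory Num.Theory.
Local Open Scope ring_scope.

Theorem theorem18 (R : realType) (t : nat) (delta c : R) :
  (0 < t)%N -> 0 < delta -> delta <= 1 -> 0 < c ->
  exists2 c' : R, 0 < c' &
    forall G : sgraph,
      connected_graph G -> (4 <= #|G|)%N ->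
      minor_free (complete_bipartite 2 t) G ->
      (exists v0 : G, c * (#|G|%:R `^ delta) <= (degree v0)%:R) ->
      forall P : seq (seq G), vertex_separating_path_system P ->
        c' * (#|G|%:R `^ (delta / (t + 1)%:R)) <= (size P)%:R.
Proof.
move=> t0 d0 _ c0; have tR : 0 < t%:R :> R by rewrite ltr0n.
pose K : R := 15 * t%:R ^+ 2.
have K0 : 0 < K by rewrite mulr_gt0 ?exprn_gt0.
(* Solves [c n^delta <= K k^2] for the number [k] of paths, where [K k^2] bounds the degree. *)
exists (Num.sqrt (c / K)); first by rewrite sqrtr_gt0 divr_gt0.
move=> G _ n4 freeG [v0 degv] P sysP.
set n := #|G| in n4 degv *; set x := _ `^ _.
have x0 : 0 <= x := powR_ge0 _ _.
rewrite -(@ler_pXn2r _ 2) ?nnegrE ?mulr_ge0 ?sqrtr_ge0 //.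
(* Squaring doubles the exponent, and [2 / (t + 1) <= 1] since [t >= 1]; monotonicity in the
   exponent uses [n >= 1]. *)
have x2 : x ^+ 2 <= n%:R `^ delta.
  rewrite -powR_mulrn // -powRrM; apply: ler_powR; first by rewrite ler1n (leq_trans _ n4).
  rewrite -mulrA; apply: ler_piMr; first exact: ltW.
  rewrite mulrC ler_pdivrMr ?ltr0n ?addn1 //.
  by rewrite mul1r ler_nat ltnS.
have deg : (degree v0)%:R <= K * (size P)%:R ^+ 2.
  rewrite /K -mulrA -exprMn -natrM -natrX -natrM ler_nat.
  by apply: degree_path_system; rewrite // (leq_trans _ n4).
have cK : 0 <= c / K by rewrite ltW // divr_gt0.
rewrite exprMn sqr_sqrtr // mulrAC ler_pdivrMr // [leRHS]mulrC.
apply: le_trans deg; apply: le_trans degv; apply: ler_wpM2l x2; exact: ltW.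
Qed.
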